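(* Let $\Omega\subset\mathbb{R}^n$ be a bounded polyhedral domain with simplicial triangulation $\mathcal{T}$, and let $r\ge 1$. Let $B_f$, $f\in\Delta(\mathcal{T})$, be the components of the bubble transform (defined in the context). If $u\in\mathcal{P}_r\Lambda^0(\mathcal{T})$, then $B_f u\in\mathring{\mathcal{P}}_r\Lambda^0(\mathcal{T}_f)$ for all $f\in\Delta(\mathcal{T})$.
   Context: Setting: $\Omega\subset\mathbb{R}^n$ is a bounded polyhedral domain and $\mathcal{T}$ is a fixed finite (conforming) simplicial triangulation of $\Omega$ into closed $n$-simplices. $\Delta_j(\mathcal{T})$ is the set of $j$-dimensional subsimplexes of $\mathcal{T}$ and $\Delta(\mathcal{T})=\bigcup_{j=0}^n\Delta_j(\mathcal{T})$; $\Delta_n(\mathcal{T})=\mathcal{T}$; $\Delta(f)$ is the set of subsimplexes of $f$. For $f\in\Delta(\mathcal{T})$, $\mathcal{T}_f=\{T\in\mathcal{T}: f\in\Delta(T)\}$ and the macroelement is $\Omega_f=\bigcup_{T\in\mathcal{T}_f}T$. Spaces: $\mathcal{P}_r\Lambda^0(\mathcal{T})$ is the space of continuous functions on $\Omega$ whose restriction to each $T\in\mathcal{T}$ is a polynomial of degree at most $r$; $\mathcal{P}_r\Lambda^0(\mathcal{T}_f)$ is the analogous space on $\Omega_f$. $\mathring{\mathcal{P}}_r\Lambda^0(\mathcal{T}_f)$ is the space of $v\in\mathcal{P}_r\Lambda^0(\mathcal{T}_f)$ whose extension by zero to $\Omega\setminus\Omega_f$ belongs to $\mathcal{P}_r\Lambda^0(\mathcal{T})$;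 such $v$ is identified with its extension by zero. Barycentric coordinates: for a vertex $x_j$ of $\mathcal{T}$, $\lambda_j$ is the continuous piecewise linear function on $\Omega$ equal to $1$ at $x_j$ and $0$ at all other vertices. For $f=[x_0,\dots,x_m]\in\Delta_m(\mathcal{T})$ (convex hull of its vertices), $\lambda_f=(\lambda_0,\dots,\lambda_m):\Omega\to\mathcal{S}_m^c$, where $\mathcal{S}_m^c=\{\lambda\in\mathbb{R}^{m+1}:\lambda_j\ge0,\ \sum_{j=0}^m\lambda_j\le1\}$. Put $b(\lambda)=1-\sum_{j=0}^m\lambda_j$ on $\mathcal{S}_m^c$. $\mathcal{I}_m$ is the set of all subsets $I$ of $\{0,\dots,m\}$ (including $\emptyset$), $|I|$ is the cardinality, and $P_I:\mathcal{S}_m^c\to\mathcal{S}_m^c$ sets $(P_I\lambda)_i=0$ for $i\in I$ and $(P_I\lambda)_i=\lambda_i$ for $i\notin I$. Operators: for $f=[x_0,\dots,x_m]\in\Delta_m(\mathcal{T})$ with $m<n$ and $v\in L^2(\Omega_f)$, $$A_fv(\lambda)=\frac1{|\Omega_f|}\int_{\Omega_f}v\Big(y+\sum_{j=0}^m\lambda_j(x_j-y)\Big)\,dy,\qquad \lambda\in\mathcal{S}_m^c,$$ (well defined at least where $b(\lambda)>0$), and $$C_fv(x)=\sum_{I\in\mathcal{I}_m}(-1)^{|I|}\frac{b(\lambda_f(x))}{b(P_I\lambda_f(x))}\,A_fv(P_I\lambda_f(x)),\qquad x\in\Omega .$$ For $f\in\Delta_n(\mathcal{T})$, $C_fv=v|_f$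 (extended by zero to $\Omega$). The component maps of the bubble transform are defined recursively in $\dim f$: for $f\in\Delta_m(\mathcal{T})$, $$B_fu=C_fu^m,\qquad u^m=u-\sum_{g\in\Delta(\mathcal{T}),\ \dim g<m}B_gu,$$ so $u^0=u$ ($C_f$ is applied to the restriction of $u^m$ to $\Omega_f$). *)

(* Defs.v *)
From HB Require Import structures.
From mathcomp Require Import all_boot all_order all_algebra.
(* mpoly's notations and the name isMeasure clash with MathComp-Analysis *)
From mathcomp Require Import -(notations) mpoly.
From mathcomp Require Import all_classical all_reals all_analysis.
From mathcomp Require Import zify.
Import numFieldNormedType.Exports.

Set Implicit Arguments.
Unset Strict Implicit.
Unset Printing Implicit Defensive.

Import Order.TTheory GRing.Theory Num.Theory.

Local Open Scope classical_set_scope.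
Local Open Scope ring_scope.

(** * Lebesgue measure on R^n *)

Section lebesgue_tuple.
Context {R : realType}.

Definition tcons n (p : measurableTypeR R * n.-tuple (measurableTypeR R)) :
  n.+1.-tuple (measurableTypeR R) := [tuple of p.1 :: p.2].

Lemma measurable_tcons n : measurable_fun [set: _] (@tcons n).
Proof. exact: measurable_cons. Qed.

Definition lebesgue_tcons n
    (mu : {sigma_finite_measure set (n.-tuple (measurableTypeR R)) -> \bar R}) :
  set (n.+1.-tuple (measurableTypeR R)) -> \bar R :=
  pushforward (@lebesgue_measure R \x mu)%E (@tcons n).

Section instances.
Variable n : nat.
Variable mu : {sigma_finite_measure set (n.-tuple (measurableTypeR R)) -> \bar R}.

Let lebesgue_tcons0 : lebesgue_tcons mu set0 = 0%E.
Proof. by rewrite /lebesgue_tcons /pushforward preimage_set0 measure0. Qed.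

Let lebesgue_tcons_ge0 A : (0 <= lebesgue_tcons mu A)%E.
Proof. exact: (measure_ge0 (product_measure1 lebesgue_measure mu)). Qed.

Let lebesgue_tcons_sigma_additive : semi_sigma_additive (lebesgue_tcons mu).
Proof.
move=> F mF tF mUF; rewrite /lebesgue_tcons /pushforward preimage_bigcup.
have mpre A : measurable A -> measurable (@tcons n @^-1` A).
  by move=> mA; rewrite -[X in measurable X]setTI; exact: measurable_tcons.
apply: measure_semi_sigma_additive.
- by move=> k; exact: mpre.
- apply/trivIsetP => /= i j _ _ ij; rewrite -preimage_setI.
  by move/trivIsetP : tF => /(_ _ _ _ _ ij) ->//; rewrite preimage_set0.
- by rewrite -preimage_bigcup; exact: mpre.
Qed.

HB.instance Definition _ := isMeasure.Build _ _ _ (lebesgue_tcons mu)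
  lebesgue_tcons0 lebesgue_tcons_ge0 lebesgue_tcons_sigma_additive.

Lemma lebesgue_tconsX A B : measurable A -> measurable B ->
  lebesgue_tcons mu [set t | A (thead t) /\ B [tuple of behead t]]
  = (lebesgue_measure A * mu B)%E.
Proof.
move=> mA mB; rewrite -product_measure1E//; congr (product_measure1 _ _ _).
by apply/seteqP; split=> -[a t] [/= Aa Bt]; split=> //=;
  move: Bt; rewrite (_ : [tuple of behead (tcons (a, t))] = t)//; exact: val_inj.
Qed.

Let lebesgue_tcons_sigma_finite : sigma_finite setT (lebesgue_tcons mu).
Proof.
have /sigma_finiteP[F [TF ndF Foo]] := sigma_finiteT (@lebesgue_measure R).
have /sigma_finiteP[G [TG ndG Goo]] := sigma_finiteT mu.
exists (fun k => [set t | F k (thead t) /\ G k [tuple of behead t]]).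
  apply/esym; rewrite -subTset => t _.
  have [i _ Fi] : (\bigcup_k F k) (thead t) by rewrite -TF.
  have [j _ Gj] : (\bigcup_k G k) [tuple of behead t] by rewrite -TG.
  exists (maxn i j) => //; split.
    by move: Fi; apply/subsetPset/ndF/leq_maxl.
  by move: Gj; apply/subsetPset/ndG/leq_maxr.
move=> k; have [mF Fk] := Foo k; have [mG Gk] := Goo k; split.
  rewrite (_ : [set _ | _] = (fun t => tnth t ord0) @^-1` F k `&`
      (fun t : n.+1.-tuple (measurableTypeR R) => [tuple of behead t]) @^-1` G k)//.
  apply: measurableI; rewrite -[X in measurable X]setTI.
    exact: measurable_tnth.
  exact: measurable_behead.
rewrite [ltLHS]lebesgue_tconsX// lte_mul_pinfty// ge0_fin_numE//.
Qed.

HB.instance Definition _ := @Measure_isSigmaFinite.Build _ _ _ (lebesgue_tcons mu)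
  lebesgue_tcons_sigma_finite.

End instances.

(* n-fold product of the one-dimensional Lebesgue measure *)
Fixpoint lebesgue_tuple n :
    {sigma_finite_measure set (n.-tuple (measurableTypeR R)) -> \bar R} :=
  if n is n'.+1 then lebesgue_tcons (lebesgue_tuple n')
  else \d_ ([tuple] : 0.-tuple (measurableTypeR R)).

Lemma lebesgue_tuple_box n (a b : 'I_n -> R) : (forall i, a i <= b i) ->
  lebesgue_tuple n [set t | forall i, tnth t i \in `[a i, b i]]
  = (\prod_(i < n) (b i - a i))%:E.
Proof.
elim: n a b => [|n IHn] a b ab.
  rewrite big_ord0 /= diracE mem_set// => -[[]//].
rewrite big_ord_recl EFinM -IHn//= -[X in (X%:E * _)%E]/(b ord0 - a ord0).
have -> : (b ord0 - a ord0)%:E = lebesgue_measure `[a ord0, b ord0]%classic.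
  rewrite lebesgue_measure_itv/= lte_fin; case: ltP => // ba.
  by rewrite (le_anti (introT andP (conj ba (ab ord0)))) subrr.
rewrite -lebesgue_tconsX//; last first.
  rewrite (_ : [set _ | _] = \bigcap_(i : 'I_n)
      ((fun t => tnth t i) @^-1` `[a (lift ord0 i), b (lift ord0 i)]%classic)).
    apply: fin_bigcap_measurable => // i _.
    by rewrite -[X in measurable X]setTI; exact: measurable_tnth.
  apply/seteqP; split => [t h i _|t h i]; first exact: (h i).
  exact: (h i Logic.I).
congr (lebesgue_tcons _ _); apply/seteqP; split=> t /=.
  move=> h; split=> [|i]; first exact: (h ord0).
  by have := h (lift ord0 i); rewrite {1}(tuple_eta t) tnthS.
move=> [h0 h] i; case: (unliftP ord0 i) => [j|] ->//.
by rewrite [in tnth t](tuple_eta t) tnthS; exact: (h j).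
Qed.

End lebesgue_tuple.
(** * Triangulated polyhedral domains *)

Section geometry.
Context {R : realType} {n : nat}.

Definition bounded_domain (Omega : set 'rV[R]_n) :=
  [/\ open Omega, connected Omega, Omega !=set0 & bounded_set Omega].

Variables (V : finType) (pos : V -> 'rV[R]_n).

Definition hull (f : {set V}) : set 'rV[R]_n :=
  [set p | exists a : V -> R, [/\ forall i, i \in f -> 0 <= a i,
    \sum_(i in f) a i = 1 & p = \sum_(i in f) a i *: pos i]].

Definition affinely_independent (f : {set V}) :=
  forall a : V -> R, \sum_(i in f) a i = 0 ->
    \sum_(i in f) a i *: pos i = 0 -> forall i, i \in f -> a i = 0.

End geometry.

(* A simplex is encoded by the set of (indices of) its vertices. The open
   domain Omega is triangulated when the closed simplices fill its closure;
   that Omega is polyhedral is the existence of such a triangulation. *)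
Record triangulation (R : realType) (n : nat) (Omega : set 'rV[R]_n) :=
  Triangulation {
    vert : finType;
    pos : vert -> 'rV[R]_n;
    cells : {set {set vert}};
    pos_inj : injective pos;
    vert_cell : forall i, exists2 K, K \in cells & i \in K;
    card_cell : forall K, K \in cells -> #|K| = n.+1;
    cell_independent : forall K, K \in cells -> affinely_independent pos K;
    (* conforming: two cells meet in a common, possibly empty, subsimplex *)
    cell_conforming : forall K L, K \in cells -> L \in cells ->
      exists2 g : {set vert}, g \subset K :&: L &
        hull pos K `&` hull pos L = hull pos g;
    cell_cover : closure Omega = \bigcup_(K in [set K | K \in cells]) hull pos K
  }.

Section mesh.
Context {R : realType} {n : nat} {Omega : set 'rV[R]_n}.
Variable T : triangulation Omega.

Local Notation V := (vert T).

Definition Delta : {set {set V}} :=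
  [set f | (f != finset.set0) && [exists K in cells T, f \subset K]]%SET.

Definition dimf (f : {set V}) : nat := #|f|.-1.

Definition star (f : {set V}) : {set {set V}} :=
  [set K in cells T | f \subset K]%SET.

Definition carrier (S : {set {set V}}) : set 'rV[R]_n :=
  \bigcup_(K in [set K | K \in S]) hull (@pos _ _ _ T) K.

Definition macroelement (f : {set V}) : set 'rV[R]_n := carrier (star f).

Definition poly_le (r : nat) (D : set 'rV[R]_n) (v : 'rV[R]_n -> R) :=
  exists2 p : mpoly.mpoly n R, (mpoly.msize p <= r.+1)%N &
    forall x, D x -> v x = mpoly.meval (fun i => x 0 i) p.

(* Functions are total, but only their values on [carrier S] are constrained. *)
Definition PLambda0 (S : {set {set V}}) (r : nat) (v : 'rV[R]_n -> R) :=
  {within carrier S, continuous v} /\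
  forall K, K \in S -> poly_le r (hull (@pos _ _ _ T) K) v.

Definition extend0 (D : set 'rV[R]_n) (v : 'rV[R]_n -> R) : 'rV[R]_n -> R :=
  patch (fun=> 0) D v.

(* [w], a function on the closure of Omega, is the extension by zero of an
   element of the space of piecewise polynomials on the macroelement of [f]. *)
Definition ringPLambda0 (f : {set V}) (r : nat) (w : 'rV[R]_n -> R) :=
  exists v : 'rV[R]_n -> R,
    [/\ PLambda0 (star f) r v,
        PLambda0 (cells T) r (extend0 (macroelement f) v) &
        forall x, closure Omega x -> w x = extend0 (macroelement f) v x].

Definition is_hat (j : V) (l : 'rV[R]_n -> R) :=
  PLambda0 (cells T) 1 l /\ forall i, l (pos i) = (i == j)%:R.

Definition hat (j : V) : 'rV[R]_n -> R := xget (fun=> 0) [set l | is_hat j l].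

(** * The bubble transform *)

(* bfun, zero_on I, average f, cmap f and bubble f are b, P_I, A_f, C_f and B_f.
   For f = [x_0, ..., x_m], the coordinates 0, ..., m of R^{m+1} are indexed
   by the vertices of f: a point of R^{m+1} is a function V -> R of which only
   the values on f are used, and I ranges over the subsets of f. *)

Definition lambda (x : 'rV[R]_n) : V -> R := fun j => hat j x.

Definition bfun (f : {set V}) (l : V -> R) : R := 1 - \sum_(j in f) l j.

Definition zero_on (I : {set V}) (l : V -> R) : V -> R :=
  fun j => if j \in I then 0 else l j.

Definition to_row (t : n.-tuple (measurableTypeR R)) : 'rV[R]_n :=
  \row_i tnth t i.

Definition average (f : {set V}) (v : 'rV[R]_n -> R) (l : V -> R) : R :=
  let D := to_row @^-1` macroelement f in
  (fine (lebesgue_tuple n D))^-1 *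
  \int[lebesgue_tuple n]_(t in D)
    v (to_row t + \sum_(j in f) l j *: (pos j - to_row t)).

(* The quotient b l / b (P_I l). Its denominator vanishes only where P_I l = l,
   that is, where it equals the numerator: the quotient is then taken to be 1
   (not 0, as x / 0 would give). In C_f v x this concerns only the points x of
   the null set f; in particular C_f v = v in the relative interior of f, which
   is the continuous extension of the formula from the complement of f. *)
Definition bquot (f : {set V}) (I : {set V}) (l : V -> R) : R :=
  if bfun f (zero_on I l) == 0 then 1 else bfun f l / bfun f (zero_on I l).

Definition cmap (f : {set V}) (v : 'rV[R]_n -> R) (x : 'rV[R]_n) : R :=
  if (dimf f < n)%N then
    \sum_(I : {set V} | I \subset f)
      (-1) ^+ #|I| * bquot f I (lambda x) * average f v (zero_on I (lambda x))
  else extend0 (hull (@pos _ _ _ T) f) v x.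

(* u^m; see [residualE] for its expression by the components bubble g u *)
Fixpoint residual (u : 'rV[R]_n -> R) (m : nat) : 'rV[R]_n -> R :=
  if m is m'.+1 then
    fun x => residual u m' x -
      \sum_(g in Delta | dimf g == m') cmap g (residual u m') x
  else u.

Definition bubble (f : {set V}) (u : 'rV[R]_n -> R) : 'rV[R]_n -> R :=
  cmap f (residual u (dimf f)).

Lemma residualE u m x :
  residual u m x = u x - \sum_(g in Delta | (dimf g < m)%N) bubble g u x.
Proof.
elim: m => [|m IHm] /=; first by rewrite big_pred0 ?subr0// => g; rewrite andbF.
rewrite IHm -addrA -opprD; congr (_ - _).
rewrite [RHS](bigID (fun g => (dimf g < m)%N))/=; congr (_ + _).
  by apply: eq_bigl => g; case: (_ \in _) => //=; lia.
apply: eq_big => [g|g /andP[_ /eqP <-]//].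
by case: (_ \in _) => //=; lia.
Qed.

End mesh.

(* Main.v *)
Require Import Defs.
From mathcomp Require Import all_boot all_order all_algebra.
From mathcomp Require Import -(notations) mpoly.
From mathcomp Require Import all_classical all_reals all_analysis.
From mathcomp Require Import measurable_realfun.
From mathcomp Require Import ring lra zify.
Import numFieldNormedType.Exports.
Import Order.TTheory GRing.Theory Num.Theory.

Set Implicit Arguments.
Unset Strict Implicit.
Unset Printing Implicit Defensive.

Local Open Scope classical_set_scope.
Local Open Scope ring_scope.

(** If [y] and the [x_j] lie in a cell [K] and [l] is in the simplex [S_m^c],
    then [y + sum_j l_j (x_j - y)] is again in [K]: hence [A_f v] is a
    polynomial of degree at most [r] in [l] whenever [v] is piecewise polynomial
    of degree at most [r]. Where [b (P_I l) = 0] its argument does not depend on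
    [y] and lies on the face [f \ I]. If [v] vanishes on the boundary of [f],
    then, for nonempty [I], [A_f v (P_I l)] is therefore divisible by
    [b (P_I l)], and the corresponding term of [C_f v] is a polynomial in
    [lambda_f] of degree at most [r]. On a cell not containing the vertex [x_j]
    of [f] the terms of [I] and of its symmetric difference with [{j}] cancel;
    on [f] itself only the term of the empty set survives, so that
    [C_f v = v] there. By induction on [m], [u^m] is piecewise polynomial and
    vanishes on all subsimplexes of dimension less than [m]. *)

(** * Polynomial functions *)

Section polynomial_functions.
Context {R : comNzRingType}.

(** Polynomials in the functions [e i], with an upper bound for the degree as index. Leaving [e]
    abstract treats polynomials on $\mathbb{R}^n$ and polynomials in $\lambda$ alike, and proofs go
    by induction on the generation. *)
Inductive polyfun (X I : Type) (e : I -> X -> R) : nat -> (X -> R) -> Prop :=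
| polyfun_cst d c : polyfun e d (fun=> c)
| polyfunD d p q : polyfun e d p -> polyfun e d q ->
    polyfun e d (fun x => p x + q x)
| polyfunXM d i p : polyfun e d p -> polyfun e d.+1 (fun x => e i x * p x).

Section theory.
Variables (X I : Type) (e : I -> X -> R).

Lemma eq_polyfun d p q : p =1 q -> polyfun e d p -> polyfun e d q.
Proof. by move=> /funext ->. Qed.

Lemma polyfunW d d' p : (d <= d')%N -> polyfun e d p -> polyfun e d' p.
Proof.
move=> + pP; elim: pP d' => {d p} [d c|d p q _ IHp _ IHq|d i p _ IHp] d' dd'.
- exact: polyfun_cst.
- by apply: polyfunD; [exact: IHp|exact: IHq].
- by case: d' dd' => // d' dd'; apply: polyfunXM; exact: IHp.
Qed.

Lemma polyfunX i : polyfun e 1 (e i).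
Proof.
apply: (@eq_polyfun _ (fun x => e i x * 1)); first by move=> x; rewrite mulr1.
exact/polyfunXM/polyfun_cst.
Qed.

Lemma polyfunZ c d p : polyfun e d p -> polyfun e d (fun x => c * p x).
Proof.
elim=> {d p} [d a|d p q _ IHp _ IHq|d i p _ IHp].
- exact: polyfun_cst.
- apply: (eq_polyfun _ (polyfunD IHp IHq)) => x; exact/esym/mulrDr.
- apply: (eq_polyfun _ (polyfunXM i IHp)) => x; exact: mulrCA.
Qed.

Lemma polyfunM d d' p q : polyfun e d p -> polyfun e d' q ->
  polyfun e (d + d') (fun x => p x * q x).
Proof.
move=> + qP; elim=> {d p} [d a|d p p' _ IHp _ IHp'|d i p _ IHp].
- exact/polyfunZ/(polyfunW _ qP)/leq_addl.
- apply: (eq_polyfun _ (polyfunD IHp IHp')) => x; exact/esym/mulrDl.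
- apply: (eq_polyfun _ (polyfunXM i IHp)) => x; exact: mulrA.
Qed.

Lemma polyfunB d p q : polyfun e d p -> polyfun e d q ->
  polyfun e d (fun x => p x - q x).
Proof.
move=> pP /(polyfunZ (-1)) qP; apply: (eq_polyfun _ (polyfunD pP qP)) => x.
by rewrite mulN1r.
Qed.

Lemma polyfun_sum (J : Type) (s : seq J) (P : pred J) d (F : J -> X -> R) :
  (forall j, P j -> polyfun e d (F j)) ->
  polyfun e d (fun x => \sum_(j <- s | P j) F j x).
Proof.
move=> FP; elim: s => [|j s IHs].
  by apply: (eq_polyfun _ (polyfun_cst e d 0)) => x; rewrite big_nil.
case: (boolP (P j)) => Pj.
  by apply: (eq_polyfun _ (polyfunD (FP j Pj) IHs)) => x; rewrite big_cons Pj.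
by apply: (eq_polyfun _ IHs) => x; rewrite big_cons (negPf Pj).
Qed.

Lemma polyfun_prodXn (n : nat) (F : 'I_n -> I) (k : 'I_n -> nat) :
  polyfun e (\sum_i k i)%N (fun x => \prod_(i < n) e (F i) x ^+ k i).
Proof.
elim: n F k => [|n IHn] F k.
  apply: (eq_polyfun _ (polyfun_cst e _ 1)) => x; by rewrite big_ord0.
rewrite big_ord_recl.
apply: (@eq_polyfun _ (fun x => e (F ord0) x ^+ k ord0 *
    \prod_(i < n) e (F (lift ord0 i)) x ^+ k (lift ord0 i))).
  by move=> x; rewrite big_ord_recl.
apply: polyfunM; last exact: IHn.
elim: (k ord0) => [|m IHm]; first exact: polyfun_cst.
by apply: (eq_polyfun _ (polyfunXM (F ord0) IHm)) => x; rewrite exprS.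
Qed.

Lemma polyfun0_cst p : polyfun e 0 p -> exists c, p = fun=> c.
Proof.
suff cst d q : polyfun e d q -> d = 0%N -> exists c, q = fun=> c.
  by move=> pP; exact: cst pP _.
elim=> {p d q} [d c|d p q _ IHp _ IHq|] // d0; first by exists c.
by have [[a ->] [b ->]] := (IHp d0, IHq d0); exists (a + b).
Qed.

End theory.

(** An affine substitution keeps the degree: each factor [e i] becomes a function of degree at most
    1. *)
Lemma polyfun_comp (X Y I J : Type) (e : I -> X -> R) (e' : J -> Y -> R)
    (phi : Y -> X) d p :
  (forall i, polyfun e' 1 (fun y => e i (phi y))) ->
  polyfun e d p -> polyfun e' d (fun y => p (phi y)).
Proof.
move=> ephi; elim=> {d p} [d c|d p q _ IHp _ IHq|d i p _ IHp].
- exact: polyfun_cst.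
- exact: polyfunD.
- by rewrite -add1n; apply: polyfunM (ephi i) IHp.
Qed.

End polynomial_functions.

(** * Polynomials in the coordinates of $\mathbb{R}^n$ *)

Definition rv_coord {R : realType} {n : nat} (i : 'I_n) (x : 'rV[R]_n) : R := x 0 i.

Definition fun_coord {R : realType} {V : Type} (j : V) (l : V -> R) : R := l j.

Section affine.
Context {R : realType} {n : nat}.

(** In degree 1 the cofactor of a coordinate has degree 0, hence is constant, so only coordinates
    and constants have to commute with affine combinations. *)
Lemma polyfun1_affine (p : 'rV[R]_n -> R) (J : Type) (s : seq J) (P : pred J)
    (a : J -> R) (y : J -> 'rV[R]_n) :
  polyfun rv_coord 1 p -> \sum_(j <- s | P j) a j = 1 ->
  p (\sum_(j <- s | P j) a j *: y j) = \sum_(j <- s | P j) a j * p (y j).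
Proof.
move=> pP a1; suff affine d q : polyfun rv_coord d q -> d = 1%N ->
    q (\sum_(j <- s | P j) a j *: y j) = \sum_(j <- s | P j) a j * q (y j).
  exact: affine pP _.
elim=> {p pP d q} [d c|d p q _ IHp _ IHq|d i p pP _] d1.
- by rewrite -mulr_suml a1 mul1r.
- by rewrite (IHp d1) (IHq d1) -big_split; apply: eq_bigr => j _; rewrite mulrDr.
- move: pP d1; case: d => // pP _; have [c ->] := polyfun0_cst pP.
  rewrite /rv_coord summxE mulr_suml; apply: eq_bigr => j _.
  by rewrite mxE mulrA.
Qed.

(** A multinomial is expanded into monomials in one direction; in the other it is built along the
    generation of [q]. *)
Lemma poly_leP (r : nat) (D : set 'rV[R]_n) (v : 'rV[R]_n -> R) :
  poly_le r D v <->
  exists2 q, polyfun rv_coord r q & forall x, D x -> v x = q x.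
Proof.
split=> [[p pr vp]|[q qP vq]].
  exists (fun x : 'rV[R]_n => mpoly.meval (fun i => x 0 i) p) => //.
  have -> : (fun x : 'rV[R]_n => mpoly.meval (fun i => x 0 i) p) =
      fun x => \sum_(m <- mpoly.msupp p | m \in mpoly.msupp p)
        mpoly.mcoeff m p * \prod_(i < n) rv_coord i x ^+ mpoly.fun_of_multinom m i.
    apply/funext => x; rewrite {1}(mpoly.mpolyE p) rmorph_sum /= -big_seq.
    by apply: eq_bigr => m _; rewrite mpoly.mevalZ mpoly.mevalX.
  apply: polyfun_sum => m mp; apply: polyfunZ.
  apply: (@polyfunW _ _ _ _ (mpoly.mdeg m)).
    by have := mpoly.msize_mdeg_lt mp; lia.
  by rewrite mpoly.mdegE; exact: polyfun_prodXn.
suff [p pr qp] : exists2 p : mpoly.mpoly n R, (mpoly.msize p <= r.+1)%N &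
    forall x : 'rV[R]_n, q x = mpoly.meval (fun i => x 0 i) p.
  by exists p => // x /vq ->.
elim: qP => {vq q r} [r c|r p q _ [P Pr pP] _ [Q Qr qQ]|r i p _ [P Pr pP]].
- exists (mpoly.mpolyC n c) => [|x]; last by rewrite mpoly.mevalC.
  by rewrite mpoly.mmeasureC; case: (c != 0).
- exists (P + Q) => [|x]; last by rewrite pP qQ mpoly.mevalD.
  by apply: leq_trans (mpoly.mmeasureD_le _ _ _) _; rewrite geq_max Pr Qr.
- exists (mpoly.mpolyX R (mpoly.mnm1 i) * P) => [|x]; last first.
    by rewrite mpoly.mevalM mpoly.mevalXU pP.
  (* The size formula for a product requires nonzero factors. *)
  have [->|P0] := eqVneq P 0; first by rewrite mulr0 mpoly.mmeasure0.
  rewrite mpoly.msizeM//.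
    by rewrite mpoly.msizeX mpoly.mdeg1; exact: Pr.
  by apply/eqP => X0; have := mpoly.msizeX R (mpoly.mnm1 i); rewrite X0 mpoly.mmeasure0.
Qed.

Lemma polyfun_continuous r (q : 'rV[R]_n -> R) :
  polyfun rv_coord r q -> continuous q.
Proof.
elim=> {r q} [r c|r p q _ cp _ cq|r i p _ cp] x.
- exact: cst_continuous.
- exact: cvgD (cp x) (cq x).
- apply: (cvgM _ (cp x)). exact: coord_continuous.
Qed.

End affine.

(** * Barycentric coordinates *)

Lemma sum_extend (V : finType) (M : nmodType) (g K : {set V}) (F : V -> M) :
  g \subset K ->
  \sum_(i in K) (if i \in g then F i else 0) = \sum_(i in g) F i.
Proof.
move=> gK; rewrite -big_mkcondr; apply: eq_bigl => i.
by rewrite andb_idl//; exact: (fintype.subsetP gK).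
Qed.

Section barycentric.
Context {R : realType} {n : nat} {Omega : set 'rV[R]_n}.
Variable T : triangulation Omega.
Local Notation V := (vert T).
Implicit Types (K L f g h : {set V}) (x : 'rV[R]_n).

(** The leading 1 of each row records the sum of the coefficients, so that one linear system
    expresses a point as an affine combination of the vertices. *)
Definition vertex_matrix K : 'M[R]_(#|K|, 1 + n) :=
  \matrix_(i < #|K|) row_mx (1%:M : 'M[R]_1) (pos (enum_val i)).

Lemma mulmx_vertex_matrix K (v : 'rV[R]_(#|K|)) :
  v *m vertex_matrix K =
  row_mx (\sum_i v 0 i)%:M (\sum_i v 0 i *: pos (enum_val i)).
Proof.
rewrite mulmx_sum_row [in RHS]raddf_sum.
under eq_bigr do rewrite rowK scale_row_mx scale_scalar_mx mulr1.
elim/big_ind3 : _ => //=; first by rewrite row_mx0.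
by move=> a b c d e f -> ->; rewrite add_row_mx.
Qed.

(** The solution of the linear system for [(1, x)], defined on all of $\mathbb{R}^n$. The sum has at
    most one term: it converts the index of a row into the vertex [j] and gives 0 when [j] is not in
    [K]. *)
Definition bary K (j : V) x : R :=
  \sum_(i < #|K| | enum_val i == j)
    (row_mx (1%:M : 'M[R]_1) x *m pinvmx (vertex_matrix K)) 0 i.

Lemma bary_enum_val K (i : 'I_#|K|) x :
  bary K (enum_val i) x =
  (row_mx (1%:M : 'M[R]_1) x *m pinvmx (vertex_matrix K)) 0 i.
Proof.
rewrite /bary (big_pred1 i)// => k; exact/inj_eq/enum_val_inj.
Qed.

Lemma bary_polyfun K j : polyfun rv_coord 1 (bary K j).
Proof.
apply: polyfun_sum => i _; move: (pinvmx _) => B.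
apply: (@eq_polyfun _ _ _ _ _ (fun x => B (lshift n ord0) i +
    \sum_(k < n) B (rshift 1 k) i * rv_coord k x)).
  move=> x; rewrite [RHS]mxE big_split_ord /= big_ord1 row_mxEl mxE eqxx mul1r.
  by congr (_ + _); apply: eq_bigr => k _; rewrite row_mxEr mulrC.
apply: polyfunD; first exact: polyfun_cst.
by apply: polyfun_sum => k _; apply/polyfunZ/polyfunX.
Qed.

Lemma bary_out K j x : j \notin K -> bary K j x = 0.
Proof.
by move=> jK; rewrite /bary big_pred0// => i; apply: contraNF jK => /eqP <-;
  exact: enum_valP.
Qed.

(** A vanishing combination of the rows is an affine dependence between the vertices of [K]. *)
Lemma row_free_vertex_matrix K : K \in cells T -> row_free (vertex_matrix K).
Proof.
move=> KT; apply: inj_row_free => v; rewrite mulmx_vertex_matrix.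
rewrite -[RHS](@row_mx0 _ _ 1) => /eq_row_mx[v1 vpos].
pose a (j : V) := \sum_(i < #|K| | enum_val i == j) v 0 i.
have aE i : a (enum_val i) = v 0 i.
  by rewrite /a (big_pred1 i)// => k; exact/inj_eq/enum_val_inj.
have a0 : \sum_(j in K) a j = 0.
  rewrite big_enum_val; under eq_bigr do rewrite aE.
  by have /matrixP/(_ 0 0) := v1; rewrite !mxE eqxx mulr1n.
have apos : \sum_(j in K) a j *: pos j = 0.
  by rewrite big_enum_val; under eq_bigr do rewrite aE.
apply/rowP => i; rewrite mxE -aE.
exact: (cell_independent KT) a0 apos _ (enum_valP i).
Qed.

(** The matrix has [n.+1] independent rows in a space of dimension [n.+1], so every row [(1, x)] is
    in its row space. *)
Lemma row_mx_bary K x : K \in cells T ->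
  row_mx (1%:M : 'M[R]_1) x =
  row_mx (\sum_(j in K) bary K j x)%:M (\sum_(j in K) bary K j x *: pos j).
Proof.
move=> KT; rewrite big_enum_val [X in _ = row_mx _ X]big_enum_val.
under eq_bigr do rewrite bary_enum_val.
under [in X in _ = row_mx _ X]eq_bigr do rewrite bary_enum_val.
rewrite -mulmx_vertex_matrix mulmxKpV//; apply: submx_full.
by rewrite /row_full (eqP (row_free_vertex_matrix KT)) (card_cell KT).
Qed.

Lemma sum_bary K x : K \in cells T -> \sum_(j in K) bary K j x = 1.
Proof.
by move=> /row_mx_bary -/(_ x) /eq_row_mx[/matrixP/(_ 0 0)]; rewrite !mxE.
Qed.

Lemma bary_pos K x : K \in cells T -> \sum_(j in K) bary K j x *: pos j = x.
Proof. by move=> /row_mx_bary -/(_ x) /eq_row_mx[]. Qed.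

(** Uniqueness of barycentric coordinates: they differ from the extension of [a] by zero by an
    affine dependence in [K]. *)
Lemma baryE K g (a : V -> R) j : K \in cells T -> g \subset K ->
  \sum_(i in g) a i = 1 ->
  bary K j (\sum_(i in g) a i *: pos i) = if j \in g then a j else 0.
Proof.
move=> KT gK a1; set x := \sum_(i in g) _.
have [jK|jK] := boolP (j \in K); last first.
  by rewrite bary_out// ifN//; apply: contra jK; exact: (fintype.subsetP gK).
apply/eqP; rewrite -subr_eq0; apply/eqP; move: j jK.
apply: (cell_independent KT).
  by rewrite sumrB sum_bary// sum_extend// a1 subrr.
under eq_bigr do rewrite scalerBl (fun_if ( *:%R^~ _)) scale0r.
by rewrite sumrB bary_pos// sum_extend// subrr.
Qed.

Lemma hull_bary K g x : K \in cells T -> g \subset K ->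
  hull (@pos _ _ _ T) g x <->
  (forall j, 0 <= bary K j x) /\ (forall j, j \notin g -> bary K j x = 0).
Proof.
move=> KT gK; split=> [[a [a0 a1 ->]]|[b0 bg]].
  split=> j; rewrite baryE//; last by move/negPf ->.
  by case: ifP => // jg; exact: a0.
exists (fun j => bary K j x); split=> //.
- rewrite -(sum_extend _ gK) -(sum_bary x KT); apply: eq_bigr => i _.
  by case: ifPn => // /bg.
- rewrite -(sum_extend _ gK) -{1}(bary_pos x KT); apply: eq_bigr => i _.
  by case: ifPn => // /bg ->; rewrite scale0r.
Qed.

Lemma cell_hull_bary K x : K \in cells T ->
  hull (@pos _ _ _ T) K x <-> forall j, 0 <= bary K j x.
Proof.
move=> KT; split=> [/(hull_bary _ KT (fintype.subxx _))[]//|b0].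
by apply/(hull_bary _ KT (fintype.subxx _)); split=> // j; exact: bary_out.
Qed.

Lemma hull_sub g h x : g \subset h ->
  hull (@pos _ _ _ T) g x -> hull (@pos _ _ _ T) h x.
Proof.
move=> gh [a [a0 a1 ->]].
exists (fun i => if i \in g then a i else 0); split.
- by move=> i ih; case: ifP => // ig; exact: a0.
- by rewrite sum_extend.
- under [RHS]eq_bigr do rewrite (fun_if ( *:%R^~ _)) scale0r.
  by rewrite sum_extend.
Qed.

Lemma hull_set0 x : ~ hull (@pos _ _ _ T) finset.set0 x.
Proof.
by move=> [a [_ + _]]; rewrite big_set0 => /eqP; rewrite eq_sym oner_eq0.
Qed.

Lemma hull_pos g j : j \in g -> hull (@pos _ _ _ T) g (pos j).
Proof.
move=> jg; exists (fun i => (i == j)%:R); split=> [i _||].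
- exact: ler0n.
- by rewrite (bigD1 j)//= eqxx big1 ?addr0// => i /andP[_ /negPf ->].
- rewrite (bigD1 j)//= eqxx scale1r big1 ?addr0// => i /andP[_ /negPf ->].
  by rewrite scale0r.
Qed.

Lemma closed_hull K : K \in cells T -> closed (hull (@pos _ _ _ T) K).
Proof.
move=> KT; have -> : hull (@pos _ _ _ T) K =
    \bigcap_(j in [set: V]) (bary K j @^-1` [set y | 0 <= y]).
  apply/seteqP; split=> x; first by move=> /(cell_hull_bary _ KT) + j _; exact.
  by move=> b0; apply/(cell_hull_bary _ KT) => j; exact: b0.
apply: closed_bigI => j _; apply: closed_comp; last exact: closed_ge.
by move=> x _; apply: (polyfun_continuous (bary_polyfun K j)).
Qed.

(** By conformity [x] lies in the hull of common vertices, and weights on these determine the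
    coordinates in both cells. *)
Lemma bary_coherent K L x j : K \in cells T -> L \in cells T ->
  hull (@pos _ _ _ T) K x -> hull (@pos _ _ _ T) L x -> bary K j x = bary L j x.
Proof.
move=> KT LT Kx Lx; have [g + KLg] := cell_conforming KT LT.
rewrite finset.subsetI => /andP[gK gL].
have [a [a0 a1 ->]] : hull (@pos _ _ _ T) g x by rewrite -KLg.
by rewrite !baryE.
Qed.

(** The cells are closed and finite in number, so continuity of a single function on their union
    follows from continuity on each of them. *)
Lemma PLambda0_local (S : {set {set V}}) r v : S \subset cells T ->
  (forall K, K \in S -> poly_le r (hull (@pos _ _ _ T) K) v) ->
  PLambda0 S r v.
Proof.
move=> ST vS; split=> //.
have -> : carrier S = \big[setU/set0]_(K <- enum S) hull (@pos _ _ _ T) K.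
  rewrite -bigcup_seq; congr bigcup; apply/seteqP.
  by split=> K /=; rewrite mem_enum.
have : {subset enum S <= S} by move=> K; rewrite mem_enum.
suff H (s : seq {set V}) : {subset s <= S} ->
    closed (\big[setU/set0]_(K <- s) hull (@pos _ _ _ T) K) /\
    {within \big[setU/set0]_(K <- s) hull (@pos _ _ _ T) K, continuous v}.
  by move=> /H[].
elim: s => [|K s IHs] sS.
  by rewrite big_nil; split; [exact: closed0|exact: continuous_subspace0].
have KS : K \in S by apply: sS; rewrite mem_head.
have KT : K \in cells T := fintype.subsetP ST _ KS.
have [|cs vs] := IHs; first by move=> L Ls; apply: sS; rewrite inE Ls orbT.
rewrite big_cons; split; first by apply: closedU => //; exact: closed_hull.
apply: withinU_continuous => //; first exact: closed_hull.
have /poly_leP[q qP vq] := vS _ KS.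
apply: (@subspace_eq_continuous _ _ _ q); last first.
  exact/continuous_subspaceT/(polyfun_continuous qP).
by move=> x /set_mem Kx; exact/esym/vq.
Qed.

(** The function [hat] is a chosen one, so a witness is needed: the barycentric coordinates of the
    cells, glued together. *)
Lemma is_hat_hat (j : V) : is_hat j (hat j).
Proof.
apply: (@xgetPex _ (fun=> 0) [set l | is_hat j l]).
(* Which cell containing [x] is picked does not matter, by [bary_coherent]; off the mesh the value 0
   is arbitrary. *)
pose l x := if [pick K in cells T | `[< hull (@pos _ _ _ T) K x >]] is Some K
            then bary K j x else 0.
have lE K x : K \in cells T -> hull (@pos _ _ _ T) K x -> l x = bary K j x.
  move=> KT Kx; rewrite /l; case: pickP => [L /andP[LT /asboolP Lx]|/(_ K)].
    exact: bary_coherent.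
  by rewrite KT /= => /asboolP.
exists l; split=> [|i].
  apply: PLambda0_local => // K KT; apply/poly_leP; exists (bary K j).
    exact: bary_polyfun.
  by move=> x; exact: lE.
have [K KT iK] := vert_cell i.
rewrite (lE _ _ KT (hull_pos iK)).
(* The vertex is the affine combination of itself alone, with weight 1. *)
have := @baryE K [set i]%SET (fun=> 1) j KT.
rewrite !big_set1 scale1r => ->//; last by rewrite finset.sub1set.
by rewrite finset.in_set1 eq_sym; case: eqP.
Qed.

(** A hat is affine on [K], hence determined there by its values at the vertices. *)
Lemma lambdaE K x (j : V) : K \in cells T -> hull (@pos _ _ _ T) K x ->
  lambda x j = bary K j x.
Proof.
move=> KT Kx; have [[_ hatK] hatpos] := is_hat_hat j.
have /poly_leP[q qP hq] := hatK _ KT.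
rewrite /lambda hq// -[in LHS](bary_pos x KT) polyfun1_affine ?sum_bary//.
rewrite (eq_bigr (fun i => bary K i x * (i == j)%:R)); last first.
  by move=> i iK; rewrite -hq ?hatpos//; exact: hull_pos.
have [jK|jK] := boolP (j \in K); last first.
  rewrite bary_out// big1// => i iK; rewrite (_ : i == j = false) ?mulr0//.
  by apply: contraNF jK => /eqP <-.
rewrite (bigD1 j)//= eqxx mulr1 big1 ?addr0// => i /andP[_ /negPf ->].
by rewrite mulr0.
Qed.

End barycentric.

(** * Averages of piecewise polynomials *)

Section bounded_measurable.
Context d {X : measurableType d} {R : realType}.
Variables (mu : {measure set X -> \bar R}) (D : set X).
Hypotheses (mD : measurable D) (Doo : (mu D < +oo)%E).
Implicit Types w : X -> R.

(** On a set of finite measure such functions are integrable; unlike integrable functions they are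
    also closed under products. *)
Definition bmeas w := measurable_fun D w /\ exists M, forall t, D t -> `|w t| <= M.

Lemma bmeas_cst c : bmeas (fun=> c).
Proof. by split; [exact: measurable_cst|exists `|c|]. Qed.

Lemma bmeasD w w' : bmeas w -> bmeas w' -> bmeas (fun t => w t + w' t).
Proof.
move=> [mw [M wM]] [mw' [M' wM']]; split; first exact: measurable_funD.
exists (M + M') => t Dt; apply: le_trans (ler_normD _ _) _.
by apply: lerD; [exact: wM|exact: wM'].
Qed.

Lemma bmeasM w w' : bmeas w -> bmeas w' -> bmeas (fun t => w t * w' t).
Proof.
move=> [mw [M wM]] [mw' [M' wM']]; split; first exact: measurable_funM.
exists (M * M') => t Dt; rewrite normrM.
by apply: ler_pM => //; [exact: wM|exact: wM'].
Qed.

Lemma bmeas_sum (J : Type) (s : seq J) (P : pred J) (F : J -> X -> R) :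
  (forall j, P j -> bmeas (F j)) -> bmeas (fun t => \sum_(j <- s | P j) F j t).
Proof.
move=> FP; elim: s => [|j s IHs].
  by under eq_fun do rewrite big_nil; exact: bmeas_cst.
under eq_fun do rewrite big_cons.
by case Pj: (P j) => //; apply: bmeasD => //; exact: FP.
Qed.

Lemma bmeas_indic (A : set X) : measurable A -> bmeas (\1_A).
Proof.
move=> mA; split; first exact: measurable_indic.
by exists 1 => t _; rewrite indicE ger0_norm// lern1 leq_b1.
Qed.

Lemma bmeas_integrable w : bmeas w -> mu.-integrable D (EFin \o w).
Proof.
move=> [mw [M wM]]; apply: measurable_bounded_integrable => //.
exists M; split; first exact: num_real.
by move=> M' MM' t Dt; exact: le_trans (wM _ Dt) (ltW MM').
Qed.

Lemma Rintegral_sum (J : Type) (s : seq J) (P : pred J) (F : J -> X -> R) :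
  (forall j, P j -> bmeas (F j)) ->
  \int[mu]_(t in D) (\sum_(j <- s | P j) F j t) =
  \sum_(j <- s | P j) \int[mu]_(t in D) F j t.
Proof.
move=> FP; elim: s => [|j s IHs].
  under eq_Rintegral do rewrite big_nil.
  by rewrite big_nil Rintegral_cst// mul0r.
under eq_Rintegral do rewrite big_cons.
rewrite big_cons; case Pj: (P j) => //; rewrite RintegralD ?IHs//.
  exact/bmeas_integrable/FP.
exact/bmeas_integrable/bmeas_sum.
Qed.

Section averaging.
Context {n : nat} {V : finType}.
Variables (y : X -> 'rV[R]_n) (f : {set V}) (p : V -> 'rV[R]_n).
Hypothesis ybm : forall i, bmeas (fun t => y t 0 i).

Let phi t (l : V -> R) := y t + \sum_(j in f) l j *: (p j - y t).

Let phiE t l i :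
  phi t l 0 i = y t 0 i + \sum_(j in f) l j * (p j 0 i - y t 0 i).
Proof. by rewrite mxE summxE; congr (_ + _); apply: eq_bigr => j _; rewrite !mxE. Qed.

Let diff_bmeas i j : bmeas (fun t => p j 0 i - y t 0 i).
Proof.
apply: bmeasD; first exact: bmeas_cst.
have -> : (fun t => - y t 0 i) = (fun t => (-1) * y t 0 i).
  by apply/funext => t; rewrite mulN1r.
by apply: bmeasM => //; exact: bmeas_cst.
Qed.

Let polyfun_bmeas r q l : polyfun rv_coord r q -> bmeas (fun t => q (phi t l)).
Proof.
elim=> {r q} [r c|r q q' _ IHq _ IHq'|r i q _ IHq].
- exact: bmeas_cst.
- exact: bmeasD.
- apply: bmeasM => //; rewrite /rv_coord; under eq_fun do rewrite phiE.
  apply: bmeasD => //; apply: bmeas_sum => j _.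
  by apply: bmeasM => //; exact: bmeas_cst.
Qed.

(** A coordinate of [phi t l] is affine in [l] with coefficients depending on [t]. These pass into
    the weight, so the induction on [q] runs over all weights at once. *)
Lemma polyfun_Rintegral r q w : polyfun rv_coord r q -> bmeas w ->
  polyfun fun_coord r (fun l => \int[mu]_(t in D) (w t * q (phi t l))).
Proof.
move=> qP; elim: qP w => {r q} [r c|r q q' qP IHq qP' IHq'|r i q qP IHq] w wbm.
- exact: polyfun_cst.
- apply: eq_polyfun (polyfunD (IHq _ wbm) (IHq' _ wbm)) => l.
  rewrite -RintegralD//; last 2 first.
    apply: bmeas_integrable; apply: bmeasM => //; exact: polyfun_bmeas qP.
    apply: bmeas_integrable; apply: bmeasM => //; exact: polyfun_bmeas qP'.
  by apply: eq_Rintegral => t _; rewrite mulrDr.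
- have wy : bmeas (fun t => w t * y t 0 i) by exact: bmeasM.
  have wz j : bmeas (fun t => w t * (p j 0 i - y t 0 i)) by exact: bmeasM.
  have qbm l : bmeas (fun t => q (phi t l)) by exact: polyfun_bmeas qP.
  have : polyfun fun_coord r.+1 (fun l =>
      \int[mu]_(t in D) (w t * y t 0 i * q (phi t l)) + \sum_(j in f) fun_coord j l *
      \int[mu]_(t in D) (w t * (p j 0 i - y t 0 i) * q (phi t l))).
    apply: polyfunD; first exact: polyfunW (leqnSn _) (IHq _ wy).
    by apply: polyfun_sum => j _; apply: polyfunXM; exact: IHq.
  apply: eq_polyfun => l; rewrite /fun_coord.
  rewrite (eq_bigr (fun j => \int[mu]_(t in D)
      (l j * (w t * (p j 0 i - y t 0 i) * q (phi t l))))); last first.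
    by move=> j _; rewrite RintegralZl//; apply: bmeas_integrable; exact: bmeasM.
  rewrite -Rintegral_sum; last first.
    by move=> j _; apply: bmeasM; [exact: bmeas_cst|exact: bmeasM].
  rewrite -RintegralD//; last 2 first.
    by apply: bmeas_integrable; exact: bmeasM.
    apply: bmeas_integrable; apply: bmeas_sum => j _.
    by apply: bmeasM; [exact: bmeas_cst|exact: bmeasM].
  apply: eq_Rintegral => t _; rewrite /rv_coord phiE mulrDl mulrDr.
  congr (_ + _); first by rewrite mulrA.
  by rewrite mulr_suml mulr_sumr; apply: eq_bigr => j _; ring.
Qed.

(* The pieces may overlap: the indicator of the union is split as
   [1_A + (1 - 1_A) 1_B], the second factor being absorbed in the weight. *)
Lemma piecewise_polyfun_Rintegral (A : set (V -> R)) (I : eqType) (s : seq I)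
    (H : I -> set X) r (v : 'rV[R]_n -> R) :
  (forall k, k \in s -> measurable (H k)) ->
  (forall k, k \in s -> exists2 q, polyfun rv_coord r q &
    forall t l, H k t -> A l -> v (phi t l) = q (phi t l)) ->
  let U := \big[setU/set0]_(k <- s) H k in
  (forall l, A l -> bmeas (fun t => \1_U t * v (phi t l))) /\
  forall w, bmeas w -> exists2 q, polyfun fun_coord r q &
    forall l, A l -> \int[mu]_(t in D) (w t * (\1_U t * v (phi t l))) = q l.
Proof.
elim: s => [_ _ /=|k s IHs mH vH /=].
  split=> [l Al|w wbm].
    by under eq_fun do rewrite big_nil indic0 mul0r; exact: bmeas_cst.
  exists (fun=> 0); first exact: polyfun_cst.
  move=> l Al; under eq_Rintegral do rewrite big_nil indic0 mul0r mulr0.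
  by rewrite Rintegral_cst// mul0r.
have [||IHbm IHint] := IHs.
- by move=> i si; apply: mH; rewrite inE si orbT.
- by move=> i si; apply: vH; rewrite inE si orbT.
have mHk : measurable (H k) by apply: mH; rewrite mem_head.
have [q qP vq] := vH _ (mem_head _ _).
set U := \big[setU/set0]_(i <- s) H i in IHbm IHint.
have Hkbm := bmeas_indic mHk.
have Hkbm' : bmeas (fun t => 1 + (-1) * \1_(H k) t).
  by apply: bmeasD; [exact: bmeas_cst|apply: bmeasM => //; exact: bmeas_cst].
have E t l : A l -> \1_(\big[setU/set0]_(i <- k :: s) H i) t * v (phi t l) =
    \1_(H k) t * q (phi t l) + (1 + (-1) * \1_(H k) t) * (\1_U t * v (phi t l)).
  move=> Al; rewrite big_cons -/U !indicE in_setU.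
  have [/set_mem Hkt|_] /= := boolP (t \in H k); last by ring.
  by rewrite (vq _ _ Hkt Al); ring.
have qbm l : bmeas (fun t => q (phi t l)) by exact: polyfun_bmeas qP.
split=> [l Al|w wbm].
  under eq_fun do rewrite E//.
  by apply: bmeasD; apply: bmeasM => //; exact: IHbm.
have [q' q'P Iq'] := IHint _ (bmeasM wbm Hkbm').
exists (fun l => \int[mu]_(t in D) (w t * \1_(H k) t * q (phi t l)) + q' l).
  by apply: polyfunD q'P; apply: polyfun_Rintegral => //; exact: bmeasM.
move=> l Al; rewrite -Iq'// -RintegralD//; last 2 first.
  by apply: bmeas_integrable; apply: bmeasM => //; exact: bmeasM.
  by apply: bmeas_integrable; apply: bmeasM; [exact: bmeasM|exact: IHbm].
by apply: eq_Rintegral => t _; rewrite E//; ring.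
Qed.

End averaging.
End bounded_measurable.

(** The simplex $\mathcal{S}_m^c$ in the coordinates indexed by [f]; the other values of [l] are
    free. *)
Definition admissible {R : realType} {V : finType} (f : {set V}) : set (V -> R) :=
  [set l | (forall j, j \in f -> 0 <= l j) /\ \sum_(j in f) l j <= 1].

(** * Measurability and measure of cells and macroelements *)

Section lebesgue_polyfun.
Context {R : realType} {n : nat}.

Lemma measurable_polyfun r (q : 'rV[R]_n -> R) :
  polyfun rv_coord r q -> measurable_fun setT (fun t => q (to_row t)).
Proof.
elim=> {r q} [r c|r p q _ mp _ mq|r i p _ mp].
- exact: measurable_cst.
- exact: measurable_funD.
- apply: measurable_funM mp; rewrite /rv_coord; under eq_fun do rewrite mxE.
  exact: measurable_tnth.
Qed.

Lemma measurable_tuple_box (a b : 'I_n -> R) :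
  measurable [set t : n.-tuple (measurableTypeR R) |
    forall i, tnth t i \in `[a i, b i]].
Proof.
rewrite (_ : [set _ | _] = \bigcap_(i : 'I_n)
    ((fun t => tnth t i) @^-1` `[a i, b i]%classic)).
  apply: fin_bigcap_measurable => // i _.
  by rewrite -[X in measurable X]setTI; exact: measurable_tnth.
by apply/seteqP; split => [t h i _|t h i]; [exact: (h i)|exact: (h i Logic.I)].
Qed.

End lebesgue_polyfun.

Section star.
Context {R : realType} {n : nat} {Omega : set 'rV[R]_n}.
Variable T : triangulation Omega.
Local Notation V := (vert T).
Implicit Types (K L f g h : {set V}) (x : 'rV[R]_n).

(** One bound for all hulls: it bounds the integration variable and encloses every macroelement in a
    box. *)
Lemma hull_coord_le g x i : hull (@pos _ _ _ T) g x ->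
  `|x 0 i| <= \sum_(j : V) `|@pos _ _ _ T j 0 i|.
Proof.
move=> [a [a0 a1 ->]]; rewrite summxE; apply: le_trans (ler_norm_sum _ _ _) _.
rewrite [leRHS](bigID (mem g))/= -[leLHS]addr0 lerD ?sumr_ge0//.
apply: ler_sum => j jg; rewrite mxE normrM ler_piMl// ger0_norm ?a0//.
rewrite -a1 (bigD1 j)//= lerDl sumr_ge0// => k /andP[kg _]; exact: a0.
Qed.

Lemma measurable_hull K : K \in cells T ->
  measurable (to_row @^-1` hull (@pos _ _ _ T) K).
Proof.
move=> KT; have -> : to_row @^-1` hull (@pos _ _ _ T) K =
    \bigcap_(j in [set: V]) ((fun t => bary K j (to_row t)) @^-1` `[0, +oo[).
  apply/seteqP; split=> t /=.
    by move=> /(cell_hull_bary _ KT) b0 j _ /=; rewrite in_itv/= b0.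
  move=> b0; apply/(cell_hull_bary _ KT) => j.
  by have /= := b0 j Logic.I; rewrite in_itv/= andbT.
apply: fin_bigcap_measurable => // j _; rewrite -[X in measurable X]setTI.
by apply: (measurable_polyfun (bary_polyfun K j)).
Qed.

Lemma preimage_macroelement f : to_row @^-1` macroelement f =
  \big[setU/set0]_(K <- enum (star f)) (to_row @^-1` hull (@pos _ _ _ T) K).
Proof.
rewrite -bigcup_seq /macroelement /carrier preimage_bigcup.
by congr bigcup; apply/seteqP; split=> K /=; rewrite mem_enum.
Qed.

Lemma star_cells f : star f \subset cells T.
Proof. by apply/fintype.subsetP => K; rewrite inE => /andP[]. Qed.

Lemma measurable_macroelement f : measurable (to_row @^-1` macroelement f).
Proof.
rewrite preimage_macroelement big_seq; apply: bigsetU_measurable => K.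
rewrite mem_enum => /(fintype.subsetP (star_cells f)); exact: measurable_hull.
Qed.

Lemma macroelement_fin f :
  (lebesgue_tuple n (to_row @^-1` macroelement f) < +oo)%E.
Proof.
pose M i := \sum_(j : V) `|@pos _ _ _ T j 0 i|.
have M0 i : 0 <= M i by exact: sumr_ge0.
have := @lebesgue_tuple_box R n (fun i => - M i) M.
move=> /(_ (fun i => snd (ge0_cp (M0 i)))) boxE.
apply: (@le_lt_trans _ _ (lebesgue_tuple n
    [set t | forall i, tnth t i \in `[- M i, M i]])); last first.
  by rewrite boxE ltry.
apply: le_measure; rewrite ?inE.
- exact: measurable_macroelement.
- exact: measurable_tuple_box.
- move=> t [K _ Kt] i; have := hull_coord_le i Kt.
  by rewrite mxE in_itv /= ler_norml.
Qed.

(** All barycentric coordinates are positive at the barycentre, hence nonnegative on a box around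
    it. *)
Lemma hull_gt0 K : K \in cells T ->
  (0 < lebesgue_tuple n (to_row @^-1` hull (@pos _ _ _ T) K))%E.
Proof.
move=> KT; pose c : 'rV[R]_n := \sum_(j in K) n.+1%:R^-1 *: pos j.
have cK j : j \in K -> 0 < bary K j c.
  move=> jK; rewrite (@baryE _ _ _ _ K K (fun=> n.+1%:R^-1))// ?jK ?invr_gt0//.
  by rewrite sumr_const (card_cell KT) -[LHS]mulr_natr mulVf// pnatr_eq0.
have : \forall x \near c, forall j : V, j \in K -> 0 < bary K j x.
  apply: (filter_forall (nbhs_filter c)) => j; have [jK|jK] := boolP (j \in K); last first.
    exact: nearW.
  have cj : continuous (bary K j) := polyfun_continuous (bary_polyfun K j).
  have H := cj c (fun y => 0 < y) (open_nbhs_nbhs (conj (@open_gt _ 0) (cK j jK))).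
  by apply: (@filterS _ (nbhs c) (nbhs_filter c) (fun y => 0 < bary K j y)) => [y|].
move=> /nbhs_ballP[e /= e0 ce].
(* Half the radius puts the closed box inside the open ball of the sup norm. *)
pose a i := c 0 i - e / 2; pose b i := c 0 i + e / 2.
have := @lebesgue_tuple_box R n a b.
have ab i : a i <= b i by rewrite /a /b; lra.
move=> /(_ ab) boxE.
apply: (@lt_le_trans _ _ (lebesgue_tuple n
    [set t | forall i, tnth t i \in `[a i, b i]])).
  rewrite boxE lte_fin; apply: prodr_gt0 => i _; rewrite /a /b; lra.
apply: le_measure; rewrite ?inE.
- exact: measurable_tuple_box.
- exact: measurable_hull.
- move=> t tab; apply/(cell_hull_bary _ KT) => j.
  have [jK|jK] := boolP (j \in K); last by rewrite bary_out.
  apply/ltW/ce => //; split=> // i k; rewrite ord1 mxE.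
  have := tab k; rewrite in_itv/= /a /b -ball_normE /ball_ /= => /andP[? ?].
  rewrite ltr_norml; lra.
Qed.

Lemma macroelement_neq0 f : f \in Delta T ->
  fine (lebesgue_tuple n (to_row @^-1` macroelement f)) != 0.
Proof.
rewrite inE => /andP[_ /existsP[K /andP[KT fK]]].
rewrite gt_eqF// fine_gt0// macroelement_fin andbT.
apply: lt_le_trans (hull_gt0 KT) _; apply: le_measure; rewrite ?inE.
- exact: measurable_hull.
- exact: measurable_macroelement.
- by move=> t Kt; exists K => //=; rewrite inE KT.
Qed.

(** * Averages over a macroelement *)

Lemma hull_average K f x (l : V -> R) : f \subset K -> admissible f l ->
  hull (@pos _ _ _ T) K x ->
  hull (@pos _ _ _ T) K (x + \sum_(j in f) l j *: (pos j - x)).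
Proof.
move=> fK [l0 l1] [a [a0 a1 ->]]; set x' := \sum_(i in K) _.
(* The weights of [x] are scaled by $b(l)$, and [l] is added on the vertices of [f]. *)
exists (fun i => (1 - \sum_(j in f) l j) * a i + (if i \in f then l i else 0)).
split.
- move=> i iK; rewrite addr_ge0 ?mulr_ge0 ?subr_ge0 ?a0//.
  by case: ifP => // jf; exact: l0.
- by rewrite big_split -mulr_sumr a1 mulr1/= sum_extend// subrK.
- under [RHS]eq_bigr do rewrite scalerDl -scalerA (fun_if ( *:%R^~ _)) scale0r.
  rewrite big_split/= -scaler_sumr sum_extend// -/x'.
  under eq_bigr do rewrite scalerBr.
  by rewrite sumrB -scaler_suml scalerBl scale1r -!addrA [X in _ + X]addrC.
Qed.

(** By [hull_average] the argument of [v] stays in the cell of the integration variable for every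
    admissible [l], so one polynomial per cell of the star suffices. *)
Lemma average_polyfun f (v : 'rV[R]_n -> R) r :
  (forall K, K \in cells T -> poly_le r (hull (@pos _ _ _ T) K) v) ->
  exists2 q, polyfun fun_coord r q &
    forall l, admissible f l -> average f v l = q l.
Proof.
move=> vr; pose D : set (n.-tuple (measurableTypeR R)) := to_row @^-1` macroelement f.
have mD : measurable D := measurable_macroelement f.
have Doo : (lebesgue_tuple n D < +oo)%E := macroelement_fin f.
have ybm i : bmeas D (fun t => to_row t 0 i).
  split.
    under eq_fun do rewrite mxE.
    apply: measurable_funTS; exact: measurable_tnth.
  exists (\sum_(j : V) `|@pos _ _ _ T j 0 i|) => t [K _ Kt].
  exact: (hull_coord_le i Kt).
have [||_ /(_ _ (bmeas_cst D 1))[q qP Iq]] :=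
    @piecewise_polyfun_Rintegral _ _ _ (lebesgue_tuple n) D mD Doo _ _
    to_row f (@pos _ _ _ T) ybm (admissible f) _ (enum (star f))
    (fun K => to_row @^-1` hull (@pos _ _ _ T) K) r v.
- by move=> K; rewrite mem_enum => /(fintype.subsetP (star_cells f)); exact: measurable_hull.
- move=> K; rewrite mem_enum inE => /andP[KT fK].
  have /poly_leP[q qP vq] := vr _ KT; exists q => // t l Kt Al.
  exact/vq/hull_average.
exists (fun l => (fine (lebesgue_tuple n D))^-1 * q l); first exact: polyfunZ.
move=> l Al; rewrite -Iq// /average -/D; congr (_ * _).
apply: eq_Rintegral => t Dt; rewrite -preimage_macroelement -/D indicE Dt.
by rewrite !mul1r.
Qed.

(** The integration variable enters with coefficient $b(l) = 0$, so the integrand is constant. *)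
Lemma average_face f (v : 'rV[R]_n -> R) l : f \in Delta T ->
  \sum_(j in f) l j = 1 -> average f v l = v (\sum_(j in f) l j *: pos j).
Proof.
move=> fT l1; rewrite /average.
under eq_Rintegral => t _.
  under eq_bigr do rewrite scalerBr.
  rewrite sumrB -scaler_suml l1 scale1r addrC subrK; over.
rewrite Rintegral_cst; last exact: measurable_macroelement.
by rewrite mulrCA mulVf ?mulr1//; exact: macroelement_neq0.
Qed.

End star.

(** * Cancellation in alternating sums and division of polynomials *)

Lemma alternating_sum0 (R : pzRingType) (V : finType) (f : {set V}) (j : V)
    (F : {set V} -> R) : j \in f -> (forall I, F (j |: I)%SET = F I) ->
  \sum_(I : {set V} | I \subset f) (-1) ^+ #|I| * F I = 0.
Proof.
move=> jf Fj; rewrite (bigID (fun I : {set V} => j \in I))/=.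
(* Each subset containing [j] is written as [j |: I] with [I] avoiding [j], and cancels against [I],
   which has the opposite sign. *)
rewrite (reindex_onto (fun I => j |: I)%SET (fun I => I :\ j)%SET)/=; last first.
  by move=> I /andP[_]; exact: finset.setD1K.
rewrite (eq_bigl (fun I : {set V} => (I \subset f) && (j \notin I))); last first.
  move=> I; rewrite finset.subUset finset.sub1set jf finset.setU11 andbT/=.
  have [jI|jI] := boolP (j \in I); last by rewrite finset.setU1K// eqxx.
  by rewrite !andbF; apply/negP => /andP[_ /eqP E]; move: jI; rewrite -E !inE eqxx.
rewrite -big_split big1//= => I /andP[_ jI].
by rewrite Fj cardsU1 jI exprS mulN1r mulNr addNr.
Qed.

(* [S] is the increment of the coordinate [j0]: the difference of the values
   is divisible by [S], with a quotient of degree one less. *)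
Lemma polyfun_shift (R : realType) (V : finType) (j0 : V) (S : (V -> R) -> R)
    d (q : (V -> R) -> R) :
  polyfun fun_coord 1 S -> polyfun fun_coord d.+1 q ->
  exists2 Q, polyfun fun_coord d Q & forall l,
    q (fun j => l j + (if j == j0 then S l else 0)) = q l + S l * Q l.
Proof.
move=> SP; pose sh (l : V -> R) j := l j + (if j == j0 then S l else 0).
have shP j : polyfun fun_coord 1 (fun l => fun_coord j (sh l)).
  apply: polyfunD; first exact: polyfunX.
  by case: (j == j0) => //; exact: polyfun_cst.
(* In degree 0 the shift has no effect; this is the base case for a coordinate times a constant. *)
suff H e p : polyfun fun_coord e p ->
    if e is e'.+1 then exists2 Q, polyfun fun_coord e' Q &
      forall l, p (sh l) = p l + S l * Q l
    else forall l, p (sh l) = p l by exact: H.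
elim=> {d q e p} [[|d] c|[|d] p q _ IHp _ IHq|d i p pP IHp] //.
- by exists (fun=> 0) => [|l]; [exact: polyfun_cst|rewrite mulr0 addr0].
- by move=> l; rewrite IHp IHq.
- have [[P PP pE] [Q QP qE]] := (IHp, IHq).
  exists (fun l => P l + Q l) => [|l]; first exact: polyfunD.
  by rewrite pE qE; ring.
- have cP : polyfun fun_coord d (fun l => (i == j0)%:R * p (sh l)).
    exact/polyfunZ/(polyfun_comp shP pP).
  have cE l : fun_coord i (sh l) = fun_coord i l + S l * (i == j0)%:R.
    by rewrite /fun_coord /sh; case: eqP; rewrite ?mulr1 ?mulr0.
  case: d pP IHp cP => [|d] pP IHp cP.
    exists (fun l => (i == j0)%:R * p (sh l)) => // l.
    by rewrite cE IHp; ring.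
  have [P PP pE] := IHp.
  (* The shifted product is $(l_i + S\delta)\,p(sh\,l)$; the factor $p(sh\,l)$ is expanded only next
     to $l_i$. *)
  exists (fun l => fun_coord i l * P l + (i == j0)%:R * p (sh l)) => [|l].
    exact: polyfunD (polyfunXM i PP) cP.
  by rewrite cE pE; ring.
Qed.

(** * Closure properties of polynomials on a set *)

Section poly_le.
Context {R : realType} {n : nat}.
Variables (r : nat) (D : set 'rV[R]_n).

Lemma poly_le_eq v w : (forall x, D x -> v x = w x) ->
  poly_le r D w -> poly_le r D v.
Proof. by move=> vw [p pr wp]; exists p => // x Dx; rewrite vw// wp. Qed.

Lemma poly_le0 : poly_le r D (fun=> 0).
Proof. by apply/poly_leP; exists (fun=> 0) => //; exact: polyfun_cst. Qed.

Lemma poly_leZ c v : poly_le r D v -> poly_le r D (fun x => c * v x).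
Proof.
move=> /poly_leP[q qP vq]; apply/poly_leP; exists (fun x => c * q x).
  exact: polyfunZ.
by move=> x /vq ->.
Qed.

Lemma poly_leB v w : poly_le r D v -> poly_le r D w ->
  poly_le r D (fun x => v x - w x).
Proof.
move=> /poly_leP[p pP vp] /poly_leP[q qP wq]; apply/poly_leP.
exists (fun x => p x - q x); first exact: polyfunB.
by move=> x Dx; rewrite vp// wq.
Qed.

Lemma poly_le_sum (J : Type) (s : seq J) (P : pred J) (F : J -> 'rV[R]_n -> R) :
  (forall j, P j -> poly_le r D (F j)) ->
  poly_le r D (fun x => \sum_(j <- s | P j) F j x).
Proof.
move=> FP; elim: s => [|j s /poly_leP[q qP sq]].
  by apply: poly_le_eq poly_le0 => x _; rewrite big_nil.
case Pj: (P j); last first.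
  apply/poly_leP; exists q => // x Dx; rewrite big_cons Pj; exact: sq.
have /poly_leP[p pP jp] := FP _ Pj; apply/poly_leP.
exists (fun x => p x + q x); first exact: polyfunD.
by move=> x Dx; rewrite big_cons Pj jp// sq.
Qed.

End poly_le.

(** * The bubble transform *)

Section bubble.
Context {R : realType} {n : nat} {Omega : set 'rV[R]_n}.
Variable T : triangulation Omega.
Local Notation V := (vert T).
Local Notation hull := (hull (@pos _ _ _ T)).
Implicit Types (K L f g h I : {set V}) (x : 'rV[R]_n) (v : 'rV[R]_n -> R).

Lemma sum_zero_on f I (l : V -> R) :
  \sum_(j in f) zero_on I l j = \sum_(j in f :\: I) l j.
Proof.
rewrite -(sum_extend _ (finset.subsetDl f I)); apply: eq_bigr => j jf.
by rewrite /zero_on inE jf andbT; case: (j \in I).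
Qed.

Lemma eq_average f v (l l' : V -> R) : {in f, l =1 l'} ->
  average f v l = average f v l'.
Proof.
move=> ll'; rewrite /average; congr (_ * _); apply: eq_Rintegral => t _.
by congr (v (_ + _)); apply: eq_bigr => j jf; rewrite ll'.
Qed.

Lemma bfun_polyfun f : polyfun fun_coord 1 (@bfun R n Omega T f).
Proof.
apply: polyfunB; first exact: polyfun_cst.
by apply: polyfun_sum => j _; exact: polyfunX.
Qed.

Lemma zero_on_polyfun I j :
  polyfun fun_coord 1 (fun l : V -> R => fun_coord j (zero_on I l)).
Proof.
rewrite /fun_coord /zero_on; case: (j \in I); first exact: polyfun_cst.
exact: (polyfunX fun_coord j).
Qed.

Lemma zero_on_admissible f I (l : V -> R) :
  admissible f l -> admissible f (zero_on I l).
Proof.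
move=> [l0 l1]; split=> [j jf|].
  by rewrite /zero_on; case: ifP => // _; exact: l0.
rewrite sum_zero_on; apply: le_trans l1.
rewrite [leRHS](big_setID I)/= lerDr sumr_ge0// => j.
by rewrite inE => /andP[jf _]; exact: l0.
Qed.

Lemma zero_on_set0 (l : V -> R) : zero_on finset.set0 l = l.
Proof. by apply/funext => j; rewrite /zero_on inE. Qed.

Lemma bquot_set0 f (l : V -> R) : bquot f finset.set0 l = 1.
Proof.
by rewrite /bquot zero_on_set0; case: eqP => // /eqP; exact: divff.
Qed.

(** The proper subsets of the vertices span the boundary faces. The hull of the empty set is empty,
    so for a single vertex the condition is void, which starts the induction on the dimension. *)
Definition vanishes_on_boundary f v :=
  forall h x, h \proper f -> hull h x -> v x = 0.

Lemma average_boundary f v I (l : V -> R) : f \in Delta T ->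
  vanishes_on_boundary f v -> I \subset f -> I != finset.set0 ->
  (forall j, j \in f -> 0 <= l j) -> \sum_(j in f :\: I) l j = 1 ->
  average f v (zero_on I l) = 0.
Proof.
move=> fT vf If I0 l0 l1; rewrite average_face// ?sum_zero_on//.
apply: (vf (f :\: I)%SET).
  rewrite finset.properEneq finset.subsetDl andbT; apply: contraNneq I0 => E.
  rewrite -finset.subset0; apply/fintype.subsetP => i iI.
  by have := fintype.subsetP If _ iI; rewrite -E inE iI.
exists l; split=> //.
  by move=> j; rewrite inE => /andP[_]; exact: l0.
rewrite -(sum_extend _ (finset.subsetDl f I)); apply: eq_bigr => j jf.
by rewrite /zero_on inE jf andbT; case: (j \in I) => //=; rewrite scale0r.
Qed.

(** Divisibility comes from moving $P_I l$ along the coordinate of one vertex [j0] of $f \setminus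
    I$ by exactly $b(P_I l)$. The moved point has coordinate sum 1, so the average vanishes there by
    [average_boundary], and [polyfun_shift] gives the quotient. *)
Lemma bquot_average_polyfun f v r I : (1 <= r)%N -> f \in Delta T ->
  (forall K, K \in cells T -> poly_le r (hull K) v) ->
  vanishes_on_boundary f v -> I \subset f ->
  exists2 q, polyfun fun_coord r q & forall l, admissible f l ->
    bquot f I l * average f v (zero_on I l) = q l.
Proof.
move=> r1 fT vr vf If; have [q qP qE] := average_polyfun f vr.
have [->|I0] := eqVneq I finset.set0.
  by exists q => // l lf; rewrite bquot_set0 mul1r zero_on_set0 qE.
(* For $I = f$ there is no vertex [j0], but $P_I l = 0$ and $b(P_I l) = 1$: the term is a constant
   times $b(l)$, of degree 1. *)
have [->|If'] := eqVneq I f.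
  exists (fun l => average f v (fun=> 0) * bfun f l).
    by apply: polyfunZ; apply: polyfunW r1 (bfun_polyfun f).
  move=> l _; rewrite /bquot [bfun f (zero_on f l)]/bfun sum_zero_on.
  rewrite finset.setDv big_set0 subr0 oner_eq0 divr1 mulrC; congr (_ * _).
  by apply: eq_average => j jf; rewrite /zero_on jf.
have /finset.set0Pn[j0] : (f :\: I)%SET != finset.set0.
  by rewrite finset.setD_eq0; apply: contra If' => fI; rewrite finset.eqEsubset If.
rewrite inE => /andP[j0I j0f].
pose s (l : V -> R) := bfun f (zero_on I l).
have sP : polyfun fun_coord 1 s.
  exact: polyfun_comp (zero_on_polyfun I) (bfun_polyfun f).
case: r r1 qP {vr} => // r _ qP.
have [Q QP QE] := polyfun_shift j0 sP (polyfun_comp (zero_on_polyfun I) qP).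
(* The degree lost in the quotient [Q] is regained by the factor $b(l)$. *)
exists (fun l => - 1 * (bfun f l * Q l)).
  by apply: polyfunZ; rewrite -add1n; exact: polyfunM (bfun_polyfun f) QP.
move=> l lf; have [l0 l1] := lf; have zf := zero_on_admissible I lf.
have s0 : 0 <= s l by rewrite subr_ge0; case: zf.
have avgE : average f v (zero_on I l) = - (s l * Q l).
  apply/eqP; rewrite -addr_eq0 qE// -QE; apply/eqP.
  have sum1 : \sum_(j in f :\: I) (l j + (if j == j0 then s l else 0)) = 1.
    rewrite big_split/= [X in _ + X](bigD1 j0) ?inE ?j0I ?j0f//= eqxx [X in _ + (_ + X)]big1 ?addr0.
      by rewrite /s /bfun sum_zero_on subrKC.
    by move=> j /andP[_ /negPf ->].
  have l'0 j : j \in f -> 0 <= l j + (if j == j0 then s l else 0).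
    by move=> jf; rewrite addr_ge0 ?l0//; case: ifP.
  rewrite -qE; first exact: average_boundary.
  split=> [j jf|]; last by rewrite sum_zero_on sum1.
  by rewrite /zero_on; case: ifP => // _; exact: l'0.
rewrite avgE /bquot -/(s l); have [s_eq0|s_neq0] := eqVneq (s l) 0; last by field.
(* Here $0 \le b(l) \le b(P_I l) = 0$, so the polynomial vanishes together with the average, and the
   default value 1 of [bquot] does no harm. *)
have -> : bfun f l = 0.
  apply/eqP; rewrite eq_le subr_ge0 l1 andbT -s_eq0 /s /bfun sum_zero_on.
  rewrite lerD2l lerN2 [leRHS](big_setID I)/= lerDr sumr_ge0// => j.
  by rewrite inE => /andP[jf _]; exact: l0.
by rewrite s_eq0 !mul0r oppr0 !mulr0.
Qed.

(** * The maps $C_f$ on cells and on faces *)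

Lemma sum_bary_sub K f x : K \in cells T -> hull K x ->
  \sum_(j in f) bary K j x <= 1.
Proof.
move=> KT /(cell_hull_bary _ KT) b0; rewrite -(sum_bary x KT).
rewrite [leLHS](big_setID K)/= [X in _ + X]big1 ?addr0 => [|j]; last first.
  by rewrite inE => /andP[jK _]; exact: bary_out.
rewrite [leRHS](big_setID f)/= finset.setIC lerDl sumr_ge0//.
Qed.

Lemma lambda_admissible K f x : K \in cells T -> hull K x ->
  admissible f (lambda x : V -> R).
Proof.
move=> KT Kx; split=> [j jf|].
  by rewrite (lambdaE _ KT Kx); apply: (cell_hull_bary x KT).1.
under eq_bigr do rewrite (lambdaE _ KT Kx).
exact: sum_bary_sub.
Qed.

Lemma DeltaP f : reflect (f != finset.set0 /\ exists2 K, K \in cells T & f \subset K)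
  (f \in Delta T).
Proof.
rewrite inE; apply: (iffP andP) => -[f0].
  by move=> /existsP[K /andP[KT fK]]; split=> //; exists K.
by move=> [K KT fK]; split=> //; apply/existsP; exists K; rewrite KT.
Qed.

Lemma lambda_face g x j : g \in Delta T -> hull g x -> j \notin g ->
  lambda x j = 0.
Proof.
move=> /DeltaP[_ [K KT gK]] gx jg.
rewrite (lambdaE _ KT (hull_sub gK gx)).
by have [_] := (hull_bary x KT gK).1 gx; exact.
Qed.

Lemma lambda_hull g x : g \in Delta T -> hull g x ->
  \sum_(j in g) lambda x j = 1 /\ \sum_(j in g) lambda x j *: pos j = x.
Proof.
move=> gT; have /DeltaP[_ [K KT gK]] := gT.
move=> [a [a0 a1 xE]]; have gx : hull g x by exists a.
have lE j : j \in g -> lambda x j = a j.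
  move=> jg; rewrite (lambdaE _ KT (hull_sub gK gx)) xE baryE//.
  by rewrite jg.
split; first by rewrite -a1; apply: eq_bigr.
by rewrite [RHS]xE; apply: eq_bigr => j jg; rewrite lE.
Qed.

Lemma cmap_poly f v r K : (1 <= r)%N -> f \in Delta T -> (dimf f < n)%N ->
  (forall L, L \in cells T -> poly_le r (hull L) v) ->
  vanishes_on_boundary f v -> K \in cells T -> poly_le r (hull K) (cmap f v).
Proof.
move=> r1 fT fn vr vf KT; rewrite /cmap; under eq_fun do rewrite fn.
apply: poly_le_sum => I If.
have [q qP qE] := bquot_average_polyfun r1 fT vr vf If.
apply: (@poly_le_eq _ _ _ _ _ (fun x => (-1) ^+ #|I| * q (lambda x))).
  by move=> x Kx; rewrite -mulrA qE//; exact: lambda_admissible Kx.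
apply: poly_leZ; apply/poly_leP; exists (fun x => q (fun j => bary K j x)).
  by apply: polyfun_comp qP => j; exact: bary_polyfun.
by move=> x Kx; congr q; apply/funext => j; exact: lambdaE.
Qed.

(** A vertex [j] of [f] outside [g] has $\lambda_j = 0$ on [g], so $P_I$ and $P_{I\cup\{j\}}$ agree
    there and the terms cancel in pairs, whatever [v] is. Taken with a cell this bounds the support;
    taken with a face it gives the trace. *)
Lemma cmap_eq0 f v g x : (dimf f < n)%N -> g \in Delta T -> hull g x ->
  ~~ (f \subset g) -> cmap f v x = 0.
Proof.
move=> fn gT gx /fintype.subsetPn[j jf jg]; rewrite /cmap fn.
under eq_bigr do rewrite -mulrA.
have lj : lambda x j = 0 by exact: lambda_face gx jg.
have zE I : zero_on (j |: I)%SET (lambda x) = zero_on I (lambda x) :> (V -> R).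
  by apply/funext => i; rewrite /zero_on !inE; case: eqP => //= ->; rewrite lj if_same.
by apply: (alternating_sum0 jf) => I; rewrite /bquot zE.
Qed.

(** On [f] the numerator $b(\lambda_f)$ is 0, which removes the terms of nonempty [I] with nonzero
    denominator. Where the denominator is 0 the quotient is 1, but the average is then a boundary
    value of [v]. *)
Lemma cmap_face f v x : (dimf f < n)%N -> f \in Delta T ->
  vanishes_on_boundary f v -> hull f x -> cmap f v x = v x.
Proof.
move=> fn fT vf fx; have [l1 lx] := lambda_hull fT fx; rewrite /cmap fn.
have /DeltaP[_ [K KT fK]] := fT.
have [l0 _] := lambda_admissible f KT (hull_sub fK fx).
rewrite (bigD1 finset.set0) ?finset.sub0set//= big1 ?addr0.
  by rewrite finset.cards0 bquot_set0 zero_on_set0 !mul1r average_face// lx.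
move=> I /andP[If I0]; rewrite /bquot; case: eqP => [b0|_]; last first.
  by rewrite {1}/bfun l1 subrr mul0r mulr0 mul0r.
rewrite (average_boundary fT vf If I0 l0) ?mulr0//.
by apply/eqP; rewrite eq_sym -subr_eq0 -sum_zero_on; apply/eqP.
Qed.

(** * Induction on the dimension *)

Lemma dimf_card f : f \in Delta T -> #|f| = (dimf f).+1.
Proof. by move=> /DeltaP[f0 _]; rewrite prednK// finset.card_gt0. Qed.

Lemma vanishes_on_boundary_dimf f v : f \in Delta T ->
  (forall h, h \in Delta T -> (dimf h < dimf f)%N ->
    forall x, hull h x -> v x = 0) ->
  vanishes_on_boundary f v.
Proof.
move=> fT vf h x hf hx.
have hT : h \in Delta T.
  have /DeltaP[_ [K KT fK]] := fT; apply/DeltaP; split.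
    by apply/eqP => h0; move: hx; rewrite h0; exact: hull_set0.
  by exists K => //; apply: fintype.subset_trans (fintype.proper_sub hf) fK.
apply: (vf h) => //; have := proper_card hf.
by rewrite (dimf_card hT) (dimf_card fT) ltnS.
Qed.

(** Subtracting the components of dimension [m] keeps the zeros on smaller faces, since no simplex
    of dimension [m] is contained in them. On a face [h] of dimension [m] only the component of [h]
    survives, and it equals the residual there. *)
Lemma residual_spec u r m : (1 <= r)%N -> (m <= n)%N ->
  (forall K, K \in cells T -> poly_le r (hull K) u) ->
  (forall K, K \in cells T -> poly_le r (hull K) (residual T u m)) /\
  (forall h, h \in Delta T -> (dimf h < m)%N ->
    forall x, hull h x -> residual T u m x = 0).
Proof.
move=> r1 + ur; elim: m => [//|m IHm] mn; have [vr v0] := IHm (ltnW mn).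
have vf g : g \in Delta T -> dimf g = m ->
    vanishes_on_boundary g (residual T u m).
  by move=> gT gm; apply: vanishes_on_boundary_dimf => //; rewrite gm.
split=> [K KT|h hT hm x hx] /=.
  apply: poly_leB; first exact: vr.
  apply: poly_le_sum => g /andP[gT /eqP gm].
  by apply: cmap_poly => //; [rewrite gm|exact: vf].
have c0 g : g \in Delta T -> dimf g = m -> g != h ->
    cmap g (residual T u m) x = 0.
  move=> gT gm gh; apply: (@cmap_eq0 _ _ h) => //; first by rewrite gm.
  apply: contra gh => gh; rewrite eqEcard gh/= (dimf_card gT) (dimf_card hT) gm.
  exact: hm.
have [hm'|hm'] := eqVneq (dimf h) m.
  rewrite (bigD1 h) ?hT ?hm' ?eqxx//= cmap_face//; [|by rewrite hm'|exact: vf].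
  rewrite big1 ?addr0 ?subrr// => g /andP[/andP[gT /eqP gm] gh]; exact: c0.
rewrite (v0 h)//; last by rewrite ltn_neqAle hm'.
rewrite big1 ?subr0// => g /andP[gT /eqP gm]; apply: c0 => //.
by apply: contraNneq hm' => <-; rewrite gm.
Qed.

Lemma bubble_spec f u r : (1 <= r)%N -> f \in Delta T ->
  (forall K, K \in cells T -> poly_le r (hull K) u) ->
  forall K, K \in cells T -> poly_le r (hull K) (bubble f u) /\
    (~~ (f \subset K) -> forall x, hull K x -> bubble f u x = 0).
Proof.
move=> r1 fT ur K KT; have /DeltaP[_ [L LT fL]] := fT.
have fn : (dimf f <= n)%N.
  by rewrite -ltnS -(dimf_card fT) -(card_cell LT) subset_leq_card.
have [vr v0] := residual_spec r1 fn ur.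
have vf := vanishes_on_boundary_dimf fT v0.
have [ltfn|gefn] := ltnP (dimf f) n.
  split; first exact: cmap_poly.
  move=> fK x Kx; apply: (@cmap_eq0 _ _ K) => //; apply/DeltaP; split; last by exists K.
  by rewrite -finset.card_gt0 (card_cell KT).
(* In dimension [n] the simplex has as many vertices as the cell containing it. *)
have {L LT fL} fcell : f \in cells T.
  suff -> : f = L by [].
  apply/eqP; rewrite eqEcard fL (card_cell LT) (dimf_card fT) ltnS; exact: gefn.
have bE x : bubble f u x = extend0 (hull f) (residual T u (dimf f)) x.
  by rewrite /bubble /cmap ltnNge gefn.
(* A different cell meets [f] in a proper face, where the residual is 0, so the cut-off at the
   boundary of [f] creates no jump. *)
have bf0 : ~~ (f \subset K) -> forall x, hull K x -> bubble f u x = 0.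
  move=> fK x Kx; rewrite bE /extend0 patchE; case: ifPn => // /set_mem fx.
  have [h + fKh] := cell_conforming fcell KT.
  rewrite finset.subsetI => /andP[hf hK].
  apply: (vf h); last by rewrite -fKh.
  by rewrite finset.properEneq hf andbT; apply: contraNneq fK => <-.
split=> //; have [fK|fK] := boolP (f \subset K); last first.
  by apply: poly_le_eq (poly_le0 r (hull K)); exact: bf0.
have <- : f = K by apply/eqP; rewrite eqEcard fK (card_cell KT) (card_cell fcell) leqnn.
by apply: poly_le_eq (vr _ fcell) => x fx; rewrite bE /extend0 patchE mem_set.
Qed.

End bubble.

Theorem theorem4p1 (R : realType) (n : nat) (Omega : set 'rV[R]_n)
    (T : triangulation Omega) (r : nat) (u : 'rV[R]_n -> R) :
  bounded_domain Omega -> (1 <= r)%N -> PLambda0 (cells T) r u ->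
  forall f : {set vert T}, f \in Delta T -> ringPLambda0 f r (bubble f u).
Proof.
move=> _ r1 [_ ur] f fT; have bs := bubble_spec r1 fT ur.
(* Outside the macroelement every cell containing the point lies off the star, where the component
   already vanishes; extension by zero thus changes nothing on the mesh. *)
have extE K x : K \in cells T -> hull (@pos _ _ _ T) K x ->
    extend0 (macroelement f) (bubble f u) x = bubble f u x.
  move=> KT Kx; rewrite /extend0 patchE; case: ifPn => // /negP xf.
  rewrite (bs K KT).2//; apply/negP => fK; apply: xf.
  by apply/mem_set; exists K => //=; rewrite inE KT.
exists (bubble f u); split.
- apply: PLambda0_local; first exact: star_cells.
  by move=> K /(fintype.subsetP (star_cells f)) KT; exact: (bs K KT).1.
- apply: PLambda0_local => // K KT; apply: poly_le_eq (bs K KT).1 => x.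
  exact: extE.
- by move=> x; rewrite (cell_cover T) => -[K /= KT Kx]; rewrite (extE K).
Qed.
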